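(* Let $n\ge3$. Let $G$ be a graph obtained from the $n$-compartment cycle graph by adding one incoming edge, or by adding one or (if $n\ge4$) two outgoing edges. Let $In=Out=\{1\}$ and let $Leak\subseteq\{1,2,\dots,n\}$ with $|Leak|=1$. Then the model $\widetilde M=(G,In,Out,Leak)$ is generically locally identifiable, and so is the model $M=(G,In,Out,\emptyset)$ obtained by removing the leak.
   Context: A linear compartmental model $(G,In,Out,Leak)$ consists of a directed graph $G=(V,E)$ with $V=\{1,\dots,n\}$ (vertices are called compartments) and subsets $In,Out,Leak\subseteq V$. Each edge $j\to i$ has a parameter $k_{ij}$, and each $j\in Leak$ has a parameter $k_{0j}$. The compartmental matrix $A$ is the $n\times n$ matrix with off-diagonal entries $A_{ij}=k_{ij}$ if $j\to i\in E$ and $0$ otherwise, and diagonal entries $A_{ii}=-\sum_{p:\,i\to p\in E}k_{pi}$ if $i\notin Leak$, $A_{ii}=-k_{0i}-\sum_{p:\,i\to p\in E}k_{pi}$ if $i\in Leak$. Let $\partial I$ be the $n\times n$ diagonal matrix with all diagonal entries the differential operator $d/dt$, and let $(B)_{ji}$ denote $B$ with row $j$ and column $i$ removed. The input-output equations are, for $i\in Out$, $$\det(\partial I-A)\,y_i=\sum_{j\in In}(-1)^{i+j}\det\big((\partial I-A)_{ji}\big)\,u_j ,$$ with both sides expanded in powers of $d/dt$ (i.e., in derivatives of the $y_i$ and $u_j$). The coefficient map $c:\mathbb{R}^{|E|+|Leak|}\to\mathbb{R}^m$ sends the vector of parameters to the vector of all non-monic coefficients of these equations (coefficients identically equal to $1$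 are omitted, as are coefficients identically $0$). A strongly connected model with at least one input is generically locally identifiable if, outside a set of measure zero, every point of $\mathbb{R}^{|E|+|Leak|}$ has an open neighborhood $U$ such that $c|_U$ is one-to-one. The $n$-compartment cycle graph has edges $1\to2\to3\to\cdots\to n\to1$. An incoming edge is an edge $i\to1$ with $i\in\{2,3,\dots,n-1\}$; an outgoing edge is an edge $1\to j$ with $j\in\{3,4,\dots,n\}$. *)

(* Defs.v *)
From HB Require Import structures.
From mathcomp Require Import all_boot all_order all_algebra.
From mathcomp Require Import all_classical all_reals all_analysis.

Set Implicit Arguments.
Unset Strict Implicit.
Unset Printing Implicit Defensive.

Import Order.TTheory GRing.Theory Num.Theory.
Import numFieldNormedType.Exports.

Local Open Scope classical_set_scope.
Local Open Scope ring_scope.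

(* The compartments 1, ..., n are the ordinals 0, ..., n - 1 of 'I_n; the pair
   (j, i) is the edge j -> i. *)
Record compartmental_model (n : nat) := CompartmentalModel {
  edges : {set 'I_n * 'I_n};
  inputs : {set 'I_n};
  outputs : {set 'I_n};
  leaks : {set 'I_n}
}.

Section Model.
Variables (R : realType) (n : nat) (M : compartmental_model n).

Local Notation params := 'rV[R]_(#|edges M| + #|leaks M|).

(* edge_param k (j, i) is the parameter k_ij, and leak_param k j is k_0j; the
   values 0 off the edges and off the leaks are junk. *)
Definition edge_param (k : params) (e : 'I_n * 'I_n) : R :=
  if @idP (e \in edges M) is ReflectT he
  then k 0 (lshift #|leaks M| (enum_rank_in he e)) else 0.

Definition leak_param (k : params) (j : 'I_n) : R :=
  if @idP (j \in leaks M) is ReflectT hj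
  then k 0 (rshift #|edges M| (enum_rank_in hj j)) else 0.

Definition compartmental_matrix (k : params) : 'M[R]_n :=
  \matrix_(i, j)
    if i == j then
      if i \in leaks M
      then - leak_param k i - \sum_(p | (i, p) \in edges M) edge_param k (i, p)
      else - \sum_(p | (i, p) \in edges M) edge_param k (i, p)
    else if (j, i) \in edges M then edge_param k (j, i) else 0.

(* A polynomial in the operator d/dt is an element of {poly R}, 'X being d/dt;
   this is the matrix (d/dt) I - A. *)
Definition operator_matrix (k : params) : 'M[{poly R}]_n :=
  'X%:M - map_mx polyC (compartmental_matrix k).

Definition lhs_operator (k : params) : {poly R} :=
  \det (operator_matrix k).

(* The operator applied to u_j in the equation of the output i. Compartments
   are numbered from 0, which does not change the parity of i + j. *)
Definition rhs_operator (k : params) (i j : 'I_n) : {poly R} :=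
  (-1) ^+ (i + j)%N * \det (row' j (col' i (operator_matrix k))).

(* inl (i, d) stands for the coefficient of the d-th derivative of y_i in the
   equation of the output i, and inr (i, j, d) for that of the d-th derivative
   of u_j in the same equation; both operators have degree at most n. *)
Definition coef_label : finType :=
  (('I_n * 'I_n.+1) + ('I_n * 'I_n * 'I_n.+1))%type.

Definition io_coef (k : params) (l : coef_label) : R :=
  match l with
  | inl (_, d) => (lhs_operator k)`_d
  | inr (i, j, d) => (rhs_operator k i j)`_d
  end.

Definition occurring_label (l : coef_label) : bool :=
  match l with
  | inl (i, _) => i \in outputs M
  | inr (i, j, _) => (i \in outputs M) && (j \in inputs M)
  end.

Definition coef_labels : {set coef_label} :=
  [set l | [&& occurring_label l,
               ~~ `[< forall k, io_coef k l = 0 >] &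
               ~~ `[< forall k, io_coef k l = 1 >]]]%SET.

Definition coefficient_map (k : params) : 'rV[R]_#|coef_labels| :=
  \row_t io_coef k (enum_val t).

End Model.

Definition strongly_connected (n : nat) (M : compartmental_model n) : Prop :=
  forall i j : 'I_n, connect (fun v w => (v, w) \in edges M) i j.

Definition box (R : realType) (N : nat) (a b : 'rV[R]_N) : set 'rV[R]_N :=
  [set x | forall i, a 0 i <= x 0 i <= b 0 i].

Definition box_volume (R : realType) (N : nat) (a b : 'rV[R]_N) : R :=
  \prod_(i < N) (b 0 i - a 0 i).

(* Lebesgue-null subsets of R^N. The index set D makes the covering families
   countable rather than infinite, which matters only for N = 0, where every
   box has volume 1. *)
Definition measure_zero (R : realType) (N : nat) (Z : set 'rV[R]_N) : Prop :=
  forall eps : R, 0 < eps ->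
    exists (D : pred nat) (a b : nat -> 'rV[R]_N),
      [/\ forall m i, a m 0 i <= b m 0 i,
          Z `<=` \bigcup_(m in [set m | D m]) box (a m) (b m) &
          (\sum_(0 <= m <oo | D m) (box_volume (a m) (b m))%:E <= eps%:E)%E].

Definition generically_locally_identifiable (R : realType) (n : nat)
    (M : compartmental_model n) : Prop :=
  [/\ strongly_connected M,
      inputs M != finset.set0 &
      exists Z : set 'rV[R]_(#|edges M| + #|leaks M|),
        measure_zero Z /\
        forall k, ~ Z k ->
          exists U : set 'rV[R]_(#|edges M| + #|leaks M|),
            [/\ open U, U k & {in U &, injective (@coefficient_map R n M)}]].

Definition cycle_edges (n : nat) : {set 'I_n * 'I_n} :=
  [set e : 'I_n * 'I_n | val e.2 == (e.1.+1 %% n)%N]%SET.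

Definition first_compartment (n : nat) : {set 'I_n} :=
  [set i : 'I_n | val i == 0%N]%SET.

Definition incoming_edges (n : nat) : {set 'I_n * 'I_n} :=
  [set e : 'I_n * 'I_n | (0 < e.1 < n.-1)%N && (val e.2 == 0%N)]%SET.

Definition outgoing_edges (n : nat) : {set 'I_n * 'I_n} :=
  [set e : 'I_n * 'I_n | (val e.1 == 0%N) && (1 < e.2)%N]%SET.

(* Main.v *)
Require Import Defs.
From HB Require Import structures.
From mathcomp Require Import all_boot all_order all_algebra.
From mathcomp Require Import all_classical all_reals all_analysis.
From mathcomp Require Import perm ring lra zify.

(** Number the compartments 0, ..., n - 1 modulo n, so that the cycle edges are
    the i -> i + 1, and call compartment 0 the hub. Write w(j, i) for the
    parameter of the edge j -> i, and d_i for the outflow of i, the sum of its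
    leak and of its outgoing parameters; the operator matrix is then X + d_i on
    the diagonal and - w(j, i) at (i, j).

    Every chord touches the hub, so without the hub only a path is left and the
    minor at the hub is triangular: the right-hand side of the input-output
    equation is the product of the X + d_i over i != 0. Its coefficients
    determine these d_i up to a permutation, hence determine them locally
    wherever they are distinct [prod_linear_factors_near].

    If all chords enter the hub, the operator matrix is upper Hessenberg, with
    nothing above the diagonal except in the first row. Expanding along the
    first column gives
      prod_i (X + d_i) - sum_(j >= 1) c_j prod_(i > j) (X + d_i),
    with c_j = w(0, 1) ... w(j - 1, j) w(j, 0), the weight of the only simple
    cycle that closes with the edge j -> 0 [det_network]. If all chords leave
    the hub, transposing and relabelling i as - i yields the same shape. Once
    the d_i with i != 0 are known, the partial products prod_(i > j) (X + d_i)
    are a Newton basis of the polynomials of degree less than n, so d_0 and all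
    c_j can be read off [network_recovery].

    It remains to solve for the parameters, given the d_i and the c_j, when
    there is at most one leak. This is elementary algebra which divides only by
    linear forms in the parameters: the edge parameters, outflows or partial
    sums of outflows of the hub [incoming_recovery, outgoing_recovery].
    Therefore the coefficient map is locally injective off finitely many
    hyperplanes [generic_local_injectivity], each of which has measure zero
    [measure_zero_hyperplane]. The forms involved are nonzero because each of
    them involves the parameter of some cycle edge. *)

Set Implicit Arguments.
Unset Strict Implicit.
Unset Printing Implicit Defensive.

Import Order.TTheory GRing.Theory Num.Theory.
Import numFieldNormedType.Exports.

(** * Sets of measure zero *)

Section MeasureZero.
Local Open Scope classical_set_scope.
Local Open Scope ring_scope.
Variable R : realType.

Lemma uniq_sum_le (T : eqType) (s1 s2 : seq T) (P : pred T) (f : T -> R) :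
  uniq s1 -> uniq s2 -> {subset s1 <= s2} -> (forall x, 0 <= f x) ->
  \sum_(x <- s1 | P x) f x <= \sum_(x <- s2 | P x) f x.
Proof.
move=> u1 u2 s12 f0.
have /(perm_big _)-> : perm_eq s1 [seq x <- s2 | x \in s1].
  apply: uniq_perm => //; first exact: filter_uniq.
  by move=> x; rewrite mem_filter; case: (boolP (x \in s1)) => // /s12 ->.
rewrite big_filter_cond big_mkcond [leRHS]big_mkcond.
by apply: ler_sum => x _; case: (x \in s1); case: (P x) => //=.
Qed.

Lemma sum_uniq_geometric (s : seq nat) (eps : R) :
  0 <= eps -> uniq s -> \sum_(q <- s) eps / 2 ^+ q.+1 <= eps.
Proof.
move=> eps0 us.
have geo K : \sum_(q <- iota 0 K) eps / 2 ^+ q.+1 = eps - eps / 2 ^+ K.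
  elim: K => [|K IH]; first by rewrite big_nil expr0 divr1 subrr.
  rewrite -addn1 iotaD big_cat IH add0n /= big_seq1 addn1 exprS.
  by have : (2 ^+ K : R) != 0 by [apply: expf_neq0]; move=> ?; field.
pose K := (\max_(q <- s) q).+1.
apply: (@le_trans _ _ (\sum_(q <- iota 0 K) eps / 2 ^+ q.+1)).
  apply: uniq_sum_le (iota_uniq _ _) _ _ => // [q qs|q].
    by rewrite mem_iota /= ltnS; exact: leq_bigmax_seq.
  by rewrite divr_ge0 // exprn_ge0.
by rewrite geo lerBlDr lerDl divr_ge0 // exprn_ge0.
Qed.

Variable N : nat.
Implicit Types (Z : set 'rV[R]_N).

Lemma box_volume_ge0 (a b : 'rV[R]_N) :
  (forall i, a 0 i <= b 0 i) -> 0 <= box_volume a b.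
Proof. by move=> ab; apply: prodr_ge0 => i _; rewrite subr_ge0. Qed.

(** Covers indexed by an arbitrary countable type, their total volume being
    bounded through finite subfamilies: products of index types and finite types
    can then be used without choosing enumerations. *)
Definition countable_box_cover (J : countType) Z (eps : R)
    (D : pred J) (a b : J -> 'rV[R]_N) : Prop :=
  [/\ forall j i, a j 0 i <= b j 0 i,
      forall x, Z x -> exists2 j, D j & box (a j) (b j) x &
      forall s, uniq s -> \sum_(j <- s | D j) box_volume (a j) (b j) <= eps].

Lemma measure_zero_cover Z :
  (forall eps, 0 < eps ->
     exists (J : countType) (D : pred J) a b, countable_box_cover Z eps D a b) ->
  measure_zero Z.
Proof.
move=> cov eps /cov[J [D [a [b [ab Zab sab]]]]].
pose f : nat -> option J := pickle_inv.
exists (fun m => oapp D false (f m)), (fun m => oapp a 0 (f m)),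
  (fun m => oapp b 0 (f m)); split.
- by move=> m i; case: (f m) => //= j.
- move=> x /Zab[j Dj xj]; exists (pickle j); first by rewrite /= /f pickleK_inv.
  by rewrite /f pickleK_inv.
- apply: lime_le.
    apply: is_cvg_nneseries => m _ _; rewrite lee_fin box_volume_ge0 // => i.
    by case: (f m) => //= j.
  apply: nearW => K; rewrite sumEFin lee_fin.
  have us : uniq (pmap f (iota 0 K)).
    by apply: (pmap_uniq (g := pickle)) (iota_uniq _ _); exact: pickle_invK.
  apply: le_trans (sab _ us).
  rewrite /index_iota subn0 le_eqVlt; apply/orP; left; apply/eqP.
  elim: (iota 0 K) => [|m s IH]; rewrite ?big_nil // big_cons /=.
  by case: (f m) => [j|] /=; rewrite ?big_cons IH.
Qed.

Lemma cover_measure_zero Z (eps : R) : 0 < eps -> measure_zero Z ->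
  exists (D : pred nat) a b, countable_box_cover Z eps D a b.
Proof.
move=> eps0 /(_ _ eps0)[D [a [b [ab Zab sab]]]]; exists D, a, b; split=> //.
move=> s us; pose K := (\max_(q <- s) q).+1.
apply: (@le_trans _ _ (\sum_(0 <= j < K | D j) box_volume (a j) (b j))).
  rewrite /index_iota subn0; apply: uniq_sum_le (iota_uniq _ _) _ _ => //.
    by move=> q qs; rewrite mem_iota /= ltnS; exact: leq_bigmax_seq.
  by move=> q; exact: box_volume_ge0.
rewrite -lee_fin -sumEFin; apply: le_trans sab.
by apply: nneseries_lim_ge => m _ _; rewrite lee_fin box_volume_ge0.
Qed.

(** The usual argument: the i-th set gets a cover of volume eps / 2 ^ (i + 1),
    where the elements of the index type are numbered by [pickle]. *)
Lemma measure_zero_bigcup (I : countType) (Zi : I -> set 'rV[R]_N) Z :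
  (forall i, measure_zero (Zi i)) -> (forall x, Z x -> exists i, Zi i x) ->
  measure_zero Z.
Proof.
move=> nullZ ZZi; apply: measure_zero_cover => eps eps0; exists (I * nat)%type.
pose ei (i : I) : R := eps / 2 ^+ (pickle i).+1.
have /choice[f fP] (i : I) : exists c : pred nat * (nat -> 'rV[R]_N) * (nat -> 'rV[R]_N),
    countable_box_cover (Zi i) (ei i) c.1.1 c.1.2 c.2.
  have ei0 : 0 < ei i by rewrite divr_gt0 // exprn_gt0.
  have [D [a [b c]]] := cover_measure_zero ei0 (nullZ i).
  by exists (D, a, b).
exists (fun p => (f p.1).1.1 p.2), (fun p => (f p.1).1.2 p.2),
  (fun p => (f p.1).2 p.2); split.
- by move=> [i j] k /=; have [+ _ _] := fP i; apply.
- move=> x /ZZi[i xi]; have [_ /(_ _ xi)[j Dj xj] _] := fP i.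
  by exists (i, j).
- move=> s us; pose u := undup (map fst s).
  (* A finite family of pairs (set, box) is grouped by its first component. *)
  rewrite big_seq_cond (eq_bigr (fun p => \sum_(i <- u | p.1 == i)
       box_volume ((f p.1).1.2 p.2) ((f p.1).2 p.2))) -?big_seq_cond; last first.
    move=> p /andP[ps _]; rewrite -big_filter.
    rewrite (_ : [seq i <- u | p.1 == i] = [:: p.1]) ?big_seq1 //.
    rewrite (eq_filter (a2 := pred1 p.1)); last by move=> i; rewrite /= eq_sym.
    by rewrite filter_pred1_uniq ?undup_uniq// mem_undup map_f.
  under eq_bigr do rewrite big_mkcond.
  rewrite exchange_big /=.
  apply: (@le_trans _ _ (\sum_(i <- u) ei i)); last first.
    rewrite -(big_map pickle predT (fun q => eps / 2 ^+ q.+1)).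
    apply: sum_uniq_geometric; first exact: ltW.
    rewrite map_inj_uniq ?undup_uniq//; exact: (pcan_inj pickleK).
  apply: ler_sum => i _; have [_ _ /(_ [seq p.2 | p <- s & p.1 == i])] := fP i.
  rewrite big_map big_filter_cond -big_mkcondr => H.
  apply: le_trans (H _).
    rewrite le_eqVlt; apply/orP; left; apply/eqP.
    rewrite (eq_bigl (fun p => (p.1 == i) && (f i).1.1 p.2)).
      by apply: eq_bigr => p /andP[/eqP-> _].
    by move=> p /=; rewrite andbC; case: eqP => // ->.
  rewrite map_inj_in_uniq ?filter_uniq// => -[i1 j1] [i2 j2].
  by rewrite !mem_filter /= => /andP[/eqP-> _] /andP[/eqP-> _] ->.
Qed.

End MeasureZero.

(** * Hyperplanes *)

Section Hyperplane.
Local Open Scope classical_set_scope.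
Local Open Scope ring_scope.
Variable R : realType.

Lemma grid_cell (K : nat) (M t : R) : (0 < K)%N -> 0 < M -> - M <= t < M ->
  exists g : 'I_K, - M + 2 * M / K%:R * g%:R <= t
                   <= - M + 2 * M / K%:R * g%:R + 2 * M / K%:R.
Proof.
move=> K0 M0 /andP[Mt tM]; set h := 2 * M / K%:R.
have KR : 0 < K%:R :> R by rewrite ltr0n.
have h0 : 0 < h by rewrite /h divr_gt0 // mulr_gt0.
pose q := (t + M) / h.
have q0 : 0 <= q by rewrite divr_ge0 ?(ltW h0) //; lra.
have /andP[q1 q2] := truncn_itv q0.
have tq : t = q * h - M by rewrite /q divfK ?gt_eqF// addrK.
have gK : (Num.truncn q < K)%N.
  rewrite -(ltr_nat R); apply: le_lt_trans q1 _.
  rewrite /q ltr_pdivrMr // /h mulrC divfK ?gt_eqF//; lra.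
exists (Ordinal gK) => /=; rewrite -natr1 in q2.
have := ler_wpM2r (ltW h0) q1; have := ler_wpM2r (ltW h0) (ltW q2).
by rewrite tq; move=> ? ?; apply/andP; split; lra.
Qed.

(** The hyperplane is the graph over the coordinates other than i0 of a linear
    function with Lipschitz constant L for the sup norm. Cutting the base into
    K ^ N cubes of side h = 2 M / K covers the graph by as many boxes of height
    2 L h, whose total volume is of order 1 / K. *)
Lemma measure_zero_bounded_hyperplane N (v : 'I_N.+1 -> R) (i0 : 'I_N.+1)
    (M : R) : v i0 != 0 -> 0 < M ->
  measure_zero [set x : 'rV[R]_N.+1 |
    \sum_i x 0 i * v i = 0 /\ forall i, - M <= x 0 i < M].
Proof.
move=> v0 M0; pose r j := v (lift i0 j) / v i0.
pose L : R := \sum_j `|r j|.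
have L0 : 0 <= L by apply: sumr_ge0.
pose C : R := 2 * L * (2 * M) ^+ N.+1.
have C0 : 0 <= C by rewrite !mulr_ge0 // exprn_ge0 // mulr_ge0 // ltW.
apply: measure_zero_cover => eps eps0.
pose K := (Num.truncn (C / eps)).+1; pose h := 2 * M / K%:R.
have KR : 0 < K%:R :> R by rewrite ltr0n.
have h0 : 0 < h by rewrite /h divr_gt0 // mulr_gt0.
have CK : C / K%:R <= eps.
  rewrite ler_pdivrMr // mulrC -ler_pdivrMr //.
  by have /andP[_ /ltW] := truncn_itv (divr_ge0 C0 (ltW eps0)).
pose y (g : {ffun 'I_N -> 'I_K}) j : R := - M + h * (g j)%:R.
pose c g := - \sum_j y g j * r j.
exists {ffun 'I_N -> 'I_K}, xpredT.
exists (fun g => \row_i if unlift i0 i is Some j then y g j else c g - L * h).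
exists (fun g => \row_i if unlift i0 i is Some j then y g j + h else c g + L * h).
split.
- move=> g i; rewrite !mxE; case: unliftP => [j|] _; first by rewrite lerDl ltW.
  have : 0 <= L * h by rewrite mulr_ge0 // ltW.
  lra.
- move=> x [x0 xM].
  have /choice[g gP] (j : 'I_N) : exists g : 'I_K,
      - M + h * g%:R <= x 0 (lift i0 j) <= - M + h * g%:R + h.
    exact: grid_cell.
  exists (finfun g) => // i; rewrite !mxE.
  case: unliftP => [j ->|->]; first by rewrite /y ffunE gP.
  have xi0 : x 0 i0 = - \sum_j x 0 (lift i0 j) * r j.
    apply: (mulIf v0); apply/eqP; rewrite mulNr -addr_eq0; apply/eqP.
    rewrite -[RHS]x0 (bigD1_ord i0) //=; congr (_ + _).
    by rewrite mulr_suml; apply: eq_bigr => j _; rewrite /r mulrA divfK.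
  suff : `|x 0 i0 - c (finfun g)| <= L * h by rewrite ler_distl.
  rewrite xi0 /c opprK addrC -sumrB mulr_suml.
  apply: le_trans (ler_norm_sum _ _ _) _; apply: ler_sum => j _.
  rewrite -mulrBl normrM mulrC ler_wpM2l // ler_norml.
  by have := gP j; rewrite /y ffunE => /andP[? ?]; apply/andP; split; lra.
- move=> s us; apply: le_trans CK.
  rewrite (eq_bigr (fun=> h ^+ N * (2 * L * h))); last first.
    move=> g _; rewrite /box_volume (bigD1_ord i0) //= mulrC; congr (_ * _).
      rewrite -[in RHS](card_ord N) -prodr_const; apply: eq_bigr => j _.
      by rewrite !mxE liftK; ring.
    by rewrite !mxE unlift_none; ring.
  rewrite big_const_seq count_predT iter_addr_0 -[leLHS]mulr_natr.
  have sK : (size s)%:R <= K%:R ^+ N :> R.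
    rewrite -natrX ler_nat -[in leqRHS](card_ord N) -[in leqRHS](card_ord K).
    by rewrite -card_ffun -(card_uniqP us) max_card.
  apply: (@le_trans _ _ (h ^+ N * (2 * L * h) * K%:R ^+ N)).
    by rewrite ler_wpM2l // !mulr_ge0 ?exprn_ge0 // ltW.
  rewrite le_eqVlt; apply/orP; left; apply/eqP.
  have hK : 2 * M = h * K%:R by rewrite divfK ?gt_eqF.
  have -> : C = 2 * L * (h * K%:R) * (h ^+ N * K%:R ^+ N).
    by rewrite /C hK exprS exprMn mulrA.
  by move: (K%:R) KR (h ^+ N) (h) => q q0 u t; field; rewrite gt_eqF.
Qed.

Lemma scalar_row_sum N (phi : 'rV[R]_N -> R) : scalar phi ->
  forall x, phi x = \sum_i x 0 i * phi (delta_mx 0 i).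
Proof.
move=> lin_phi x.
pose phiL := GRing.isLinear.Build R 'rV[R]_N R *%R phi lin_phi.
pose f : {scalar 'rV[R]_N} := HB.pack phi phiL.
rewrite -[LHS]/(f x) [in LHS](row_sum_delta x) linear_sum.
by apply: eq_bigr => i _; rewrite linearZ.
Qed.

Lemma measure_zero_hyperplane N (phi : 'rV[R]_N -> R) : scalar phi ->
  (exists k, phi k != 0) -> measure_zero [set x | phi x = 0].
Proof.
move=> /scalar_row_sum phiE [k].
case: N phi phiE k => [|N] phi phiE k; rewrite phiE.
  by rewrite big_ord0 eqxx.
move=> nz; have [i0 vi0] : exists i, phi (delta_mx 0 i) != 0.
  apply/existsP; apply: contraNT nz; rewrite negb_exists => /forallP v0.
  by rewrite big1 // => i _; have /negPn/eqP-> := v0 i; rewrite mulr0.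
have cov (M : nat) := @measure_zero_bounded_hyperplane N
  (fun i => phi (delta_mx 0 i)) i0 M.+1%:R vi0 (ltr0Sn R M).
apply: (measure_zero_bigcup cov) => x /= x0.
pose B := \sum_i `|x 0 i|.
have B0 : 0 <= B by apply: sumr_ge0.
exists (Num.truncn B); split=> [|i]; first by rewrite -phiE.
have /andP[_ BM] := truncn_itv B0.
have : `|x 0 i| <= B by rewrite /B (bigD1 i) //= lerDl sumr_ge0.
by move=> /le_lt_trans/(_ BM); rewrite ltr_norml => /andP[/ltW-> ->].
Qed.

Lemma scalar_continuous N (phi : 'rV[R]_N -> R) : scalar phi -> continuous phi.
Proof.
move=> /scalar_row_sum phiE.
rewrite (_ : phi = fun x => \sum_i x 0 i * phi (delta_mx 0 i)); last first.
  by apply/funext.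
apply: continuous_big => [|i _ x]; first exact: add_continuous.
have cc := @coord_continuous R 1 N 0 i x.
by apply: (cvgM cc); exact: cvg_cst.
Qed.

End Hyperplane.

(** * Generic local injectivity from linear conditions *)

Section GenericInjectivity.
Local Open Scope classical_set_scope.
Local Open Scope ring_scope.
Variable R : realType.

(** Roots depend injectively on the coefficients near a point c with distinct
    entries: two roots close to different entries of c cannot coincide, so equal
    products have their factors matched index by index. *)
Lemma prod_linear_factors_near (J : finType) (c u v : J -> R) :
  (forall i j, i != j -> `|u i - c i| < `|c i - c j| / 2) ->
  (forall i j, i != j -> `|v i - c i| < `|c i - c j| / 2) ->
  \prod_j ('X + (u j)%:P) = \prod_j ('X + (v j)%:P) -> u =1 v.
Proof.
move=> uc vc uv j.
have : (\prod_j ('X + (v j)%:P)).[- u j] = 0.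
  by rewrite -uv horner_prod (bigD1 j) //= hornerD hornerX hornerC addNr mul0r.
rewrite horner_prod => /eqP/prodf_eq0[i _].
rewrite hornerD hornerX hornerC addrC subr_eq0 => /eqP vu.
have [eij|ij] := eqVneq i j; first by rewrite -vu eij.
have ji := ij; rewrite eq_sym in ji.
have := vc i j ij; have := uc j i ji; rewrite vu (distrC (c j)) => ? ?.
have := ler_distD (u j) (c i) (c j); rewrite (distrC (c i) (u j)); lra.
Qed.

(** The criterion to which the theorem is reduced. The map c determines the
    forms d_j up to a permutation, and determines x once the d_j are known and
    the forms phi_t do not vanish at x. Off the hyperplanes phi_t = 0 and
    d_i = d_j, the first ambiguity disappears locally. *)
Lemma generic_local_injectivity N (T J : finType) (C : Type)
    (phi : T -> 'rV[R]_N -> R) (d : J -> 'rV[R]_N -> R) (c : 'rV[R]_N -> C) :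
  (forall t, scalar (phi t)) -> (forall t, exists x, phi t x != 0) ->
  (forall j, scalar (d j)) -> (forall i j, i != j -> exists x, d i x != d j x) ->
  (forall x y, c x = c y ->
     \prod_j ('X + (d j x)%:P) = \prod_j ('X + (d j y)%:P)) ->
  (forall x y, (forall t, phi t x != 0) -> c x = c y ->
     (forall j, d j x = d j y) -> x = y) ->
  exists Z : set 'rV[R]_N, measure_zero Z /\
    forall k, ~ Z k -> exists U : set 'rV[R]_N,
      [/\ open U, U k & {in U &, injective c}].
Proof.
move=> lphi nzphi ld nzd cprod cinj.
pose psi (s : T + {p : J * J | p.1 != p.2}) (x : 'rV[R]_N) : R :=
  match s with inl t => phi t x | inr p => d (sval p).1 x - d (sval p).2 x end.
exists [set x | exists s, psi s x = 0]; split.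
  apply: (@measure_zero_bigcup R N _ (fun s => [set x | psi s x = 0])) => // s.
  apply: measure_zero_hyperplane; case: s => [t|[[i j] /= ij]].
  - exact: lphi.
  - by move=> a x y; rewrite /psi /= !ld; ring.
  - exact: nzphi.
  - by have [x ?] := nzd i j ij; exists x; rewrite subr_eq0.
move=> k kZ; pose gap i j := `|d i k - d j k| / 2.
exists [set x | (forall t, phi t x != 0) /\
         forall p : J * J, p.1 != p.2 -> `|d p.1 x - d p.1 k| < gap p.1 p.2].
split.
- rewrite openE => x [phix dx].
  have nphi : \forall y \near x, forall t, phi t y != 0.
    apply: (@filter_forall _ T (fun t y => phi t y != 0) _ (nbhs_filter x)) => t.
    have cphi : phi t y @[y --> x] --> phi t x by exact: scalar_continuous.
    exact: (@cvgr_neq0 _ R^o _ _ _ _ _ cphi (phix t)).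
  suff nd : \forall y \near x, forall p : J * J, p.1 != p.2 ->
      `|d p.1 y - d p.1 k| < gap p.1 p.2 by exact: filterI nphi nd.
  apply: (@filter_forall _ (J * J)%type (fun p y => p.1 != p.2 ->
    `|d p.1 y - d p.1 k| < gap p.1 p.2) _ (nbhs_filter x)) => p.
  case: (boolP (p.1 != p.2)) => pp; last by apply: nearW.
  have cd : d p.1 y @[y --> x] --> d p.1 x by exact: scalar_continuous.
  have := dx _ pp; rewrite -subr_gt0 => gap0.
  apply: filterS (@cvgr_distC_lt _ R^o _ _ (nbhs_filter x) _ _ cd _ gap0).
  move=> y; rewrite ltrBrDr => dxy _; apply: le_lt_trans dxy.
  exact: ler_distD.
- split=> [t|p pp].
    by apply/eqP => t0; apply: kZ; exists (inl t).
  rewrite subrr normr0 /gap divr_gt0 // normr_gt0 subr_eq0.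
  by apply/eqP => e; apply: kZ; exists (inr (exist _ p pp)); rewrite /= e subrr.
- move=> x y; rewrite !inE => -[phix dx] [_ dy] cxy; apply: cinj => // j.
  apply: (@prod_linear_factors_near J (d^~ k) (d^~ x) (d^~ y)); last exact: cprod.
    by move=> i1 i2 i12; exact: (dx (i1, i2)).
  by move=> i1 i2 i12; exact: (dy (i1, i2)).
Qed.

End GenericInjectivity.

(** * Determinants of Hessenberg matrices *)

Section Hessenberg.
Local Open Scope ring_scope.
Variable S : comNzRingType.

Definition hessenberg m (t e a : nat -> S) : 'M[S]_m.+1 :=
  \matrix_(i, j) if i == 0%N :> nat then t j
                 else if i == j then e j
                 else if i == j.+1 :> nat then - a j else 0.

(** Expanding along the first column leaves a triangular minor and a smaller
    matrix of the same shape. *)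
Lemma det_hessenberg m (t e a : nat -> S) :
  \det (hessenberg m t e a) = \sum_(0 <= j < m.+1)
     t j * (\prod_(i < j) a i) * \prod_(j.+1 <= i < m.+1) e i.
Proof.
elim: m t e a => [|m IH] t e a.
  rewrite (mx11_scalar (hessenberg _ _ _ _)) det_scalar1 mxE /= big_nat1.
  by rewrite big_ord0 big_geq // !mulr1.
rewrite (expand_det_col _ ord0) (bigD1 ord0) //= (bigD1 (lift ord0 ord0)) //=.
rewrite big1 ?addr0; last first.
  move=> [[|[|i]] lti] //; by rewrite mxE /= ?mul0r.
rewrite big_nat_recl //=; congr (_ + _).
  rewrite mxE /= /cofactor addn0 expr0 mul1r big_ord0 mulr1.
  congr (_ * _); rewrite det_trig.
    rewrite big_add1 /= big_mkord; apply: eq_bigr => i _.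
    by rewrite !mxE /= eqxx.
  apply/is_trig_mxP => i j ij; rewrite !mxE /=.
  rewrite -(inj_eq val_inj) /= /bump /= !add1n !eqSS.
  by rewrite !ltn_eqF // ltnW.
rewrite mxE /= /cofactor addn0 expr1 mulN1r mulrNN.
have -> : row' (lift ord0 ord0) (col' ord0 (hessenberg m.+1 t e a)) =
    hessenberg m (t \o succn) (e \o succn) (a \o succn).
  apply/matrixP => i j; rewrite !mxE /=.
  rewrite -!(inj_eq val_inj) /= /bump /= !add1n.
  by case: (val i) => [|i'] //=; rewrite add1n eqSS.
rewrite IH mulr_sumr; apply: eq_bigr => j _ /=.
by rewrite big_ord_recl [in RHS]big_add1 /= !mulrA [t _ * a _]mulrC.
Qed.

Lemma det_reindex n (s : 'S_n) (A : 'M[S]_n) :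
  \det (\matrix_(i, j) A (s i) (s j)) = \det A.
Proof.
have -> : \matrix_(i, j) A (s i) (s j) = row_perm s (col_perm s A).
  by apply/matrixP => i j; rewrite !mxE.
rewrite row_permE col_permE !det_mulmx !det_perm odd_permV mulrC -mulrA.
by rewrite -expr2 sqrr_sign mulr1.
Qed.

End Hessenberg.

(** * Newton bases *)

Section NewtonBasis.
Local Open Scope ring_scope.
Variable F : fieldType.

(** Linear independence of a Newton basis, by evaluating at the root of the last
    factor, which divides every term but the last. *)
Lemma newton_basis_free (K : nat) (c e : nat -> F) :
  \sum_(0 <= j < K) c j *: \prod_(j.+1 <= i < K) ('X + (e i)%:P) = 0 ->
  forall j, (j < K)%N -> c j = 0.
Proof.
elim: K => [_ j //|K IH].
rewrite big_nat_recr //= [X in _ + _ *: X]big_geq // alg_polyC.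
rewrite (eq_big_nat _ _ (F2 := fun j => (c j *: \prod_(j.+1 <= i < K)
  ('X + (e i)%:P)) * ('X + (e K)%:P))); last first.
  by move=> j /andP[_ jK]; rewrite big_nat_recr //= scalerAl.
rewrite -mulr_suml => eq0; have cK : c K = 0.
  have := congr1 (fun p => p.[- e K]) eq0.
  by rewrite !hornerE addNr mulr0 add0r.
move: eq0; rewrite cK addr0 => /eqP; rewrite mulf_eq0 => /orP[/eqP/IH cj|].
  by move=> j; rewrite ltnS leq_eqVlt => /orP[/eqP->//|]; exact: cj.
by rewrite -size_poly_eq0 size_XaddC.
Qed.

End NewtonBasis.

(** * Determinants of networks whose chords enter the hub *)

Section HubNetwork.
Local Open Scope ring_scope.
Variables (F : fieldType) (m : nat).
Local Notation V := 'I_m.+2.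
Implicit Types (W : V -> V -> F) (d : V -> F).

Lemma val_natr_ord (j : nat) : (j < m.+2)%N -> val (j%:R : V) = j.
Proof. by move=> jm; rewrite Zp_nat /= modn_small. Qed.

Lemma val_add1_ord (i : V) : val (i + 1) = (i.+1 %% m.+2)%N.
Proof. by rewrite /= modnDmr addn1. Qed.

(** The operator matrix of a network with edge weights [W] and outflows [d]
    prescribed independently of each other: relabelled and reversed models are
    of this form too. *)
Definition network_mx W d : 'M[{poly F}]_m.+2 :=
  \matrix_(i, j) if i == j then 'X + (d i)%:P else - (W j i)%:P.

Definition points_to_hub W := forall j i : V, i != 0 -> i != j + 1 -> W j i = 0.

Lemma network_mx_hessenberg W d : points_to_hub W ->
  network_mx W d = hessenberg m.+1
    (fun j => if j == 0%N then 'X + (d 0)%:P else - (W j%:R 0)%:P)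
    (fun j => 'X + (d j%:R)%:P) (fun j => (W j%:R j.+1%:R)%:P).
Proof.
move=> hubW; apply/matrixP => i j; rewrite !mxE.
have [i0|i0] := eqVneq (i : nat) 0%N.
  have -> : i = 0 by apply: val_inj.
  by rewrite natr_Zp eq_sym -(inj_eq val_inj) /=; case: ifP.
rewrite natr_Zp; case: eqP => [->//|_].
have i0' : i != 0 by [].
have [ij|ij] := eqVneq (i : nat) j.+1; last first.
  rewrite hubW ?oppr0 // -[j]natr_Zp natr1.
  apply: contra_neq ij => ij; move: i0'; rewrite ij.
  have [jm|jm] := ltnP j.+1 m.+2; first by rewrite val_natr_ord // natr_Zp.
  have -> : j.+1 = m.+2 by apply/eqP; rewrite eqn_leq jm andbT.
  by rewrite -(inj_eq val_inj) Zp_nat /= modnn eqxx.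
by rewrite -ij !natr_Zp.
Qed.

(** The weight of the cycle 0 -> 1 -> ... -> j -> 0. *)
Definition cycle_weight W (j : nat) : F :=
  W j%:R 0 * \prod_(i < j) W i%:R i.+1%:R.

Lemma det_network W d : points_to_hub W ->
  \det (network_mx W d) = \prod_(0 <= i < m.+2) ('X + (d i%:R)%:P) -
    \sum_(1 <= j < m.+2) cycle_weight W j *: \prod_(j.+1 <= i < m.+2) ('X + (d i%:R)%:P).
Proof.
move=> hubW; rewrite network_mx_hessenberg // det_hessenberg.
rewrite [LHS]big_ltn // [X in _ = X - _]big_ltn //= big_ord0 mulr1; congr (_ + _).
rewrite -sumrN; apply: eq_big_nat => -[//|j] _ /=.
rewrite -mul_polyC !mulNr /cycle_weight polyCM; congr (- (_ * _ * _)).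
by rewrite rmorph_prod.
Qed.

(** The difference of the two determinants is a combination of Newton basis
    polynomials with coefficients d 0 - d' 0 and the differences of the cycle
    weights. *)
Lemma network_recovery W W' d d' : points_to_hub W -> points_to_hub W' ->
  (forall i, i != 0 -> d i = d' i) ->
  \det (network_mx W d) = \det (network_mx W' d') ->
  d 0 = d' 0 /\
  forall j, (0 < j < m.+2)%N -> cycle_weight W j = cycle_weight W' j.
Proof.
move=> hubW hubW' dd'; rewrite !det_network // => eq_det.
have dj j : (0 < j < m.+2)%N -> d j%:R = d' j%:R.
  move=> /andP[j0 jm]; apply: dd'.
  by rewrite -(inj_eq val_inj) val_natr_ord //= -lt0n.
have ddP j : (0 < j)%N -> \prod_(j <= i < m.+2) ('X + (d' i%:R)%:P) =
    \prod_(j <= i < m.+2) ('X + (d i%:R)%:P).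
  move=> j0; apply: eq_big_nat => i /andP[ji im].
  by rewrite dj // im (leq_trans j0 ji).
pose c j := if j == 0%N then d 0 - d' 0 else cycle_weight W' j - cycle_weight W j.
have c0 : forall j, (j < m.+2)%N -> c j = 0.
  apply: (@newton_basis_free F m.+2 c (fun i => d i%:R)).
  rewrite [LHS]big_ltn // /c /=.
  rewrite [X in _ + X](eq_big_nat _ _ (F2 := fun j =>
     cycle_weight W' j *: \prod_(j.+1 <= i < m.+2) ('X + (d i%:R)%:P) -
     cycle_weight W j *: \prod_(j.+1 <= i < m.+2) ('X + (d i%:R)%:P))).
    rewrite sumrB -mul_polyC polyCB.
    move: eq_det; rewrite [X in X - _]big_ltn // [X in _ = X - _]big_ltn //.
    rewrite ddP // [X in _ = _ - X](eq_big_nat _ _ (F2 := fun j =>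
      cycle_weight W' j *: \prod_(j.+1 <= i < m.+2) ('X + (d i%:R)%:P))).
      move=> /eqP; rewrite -subr_eq0 => /eqP eq0.
      by rewrite -[RHS]eq0 ?mulr0n; ring.
    by move=> j _; rewrite ddP.
  by move=> [//|j] _ /=; rewrite scalerBl.
split; first by have /eqP := c0 0%N isT; rewrite subr_eq0 => /eqP.
move=> [//|j] /andP[_ jm].
by have /eqP := c0 j.+1 jm; rewrite subr_eq0 => /eqP.
Qed.

End HubNetwork.

(** * Recovering parameters from outflows and cycle weights *)

Section Recovery.
Local Open Scope ring_scope.
Variable F : fieldType.
(* A j is the parameter of the j-th edge of a path out of the hub, B j that of
    the chord or cycle edge that closes the path after j edges, and g j a leak,
    present only at l; the equations [cycles] say that the cycle weights agree. *)
Variables (n l : nat) (A B g A' B' g' : nat -> F).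
Hypothesis g_off_l : forall j, (j < n)%N -> j != l -> g j = 0.
Hypothesis g'_off_l : forall j, (j < n)%N -> j != l -> g' j = 0.

Let P j := \prod_(i < j) A i.
Let P' j := \prod_(i < j) A' i.

Let PS j : P j.+1 = P j * A j. Proof. by rewrite /P big_ord_recr. Qed.
Let P'S j : P' j.+1 = P' j * A' j. Proof. by rewrite /P' big_ord_recr. Qed.

Hypothesis cycles : forall j, (j < n)%N -> B j * P j = B' j * P' j.

(** Without a leak at j, the outflow equation multiplied by P j reads
    P (j + 1) = P j * (g j + A j + B j) - B j * P j, a recursion with known
    coefficients. Starting from P 0 = 1 it determines P j for j <= l. Run
    backwards from P n = 0, dividing by the outflows, it determines P j for
    j > l. *)
Lemma incoming_recovery : (0 < n)%N -> A n.-1 = 0 -> A' n.-1 = 0 ->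
  (forall j, (j < n)%N -> g j + A j + B j = g' j + A' j + B' j) ->
  (forall j, (j < n.-1)%N -> A j != 0) ->
  (forall j, (j < n)%N -> g j + A j + B j != 0) ->
  forall j, (j < n)%N -> [/\ A j = A' j, B j = B' j & g j = g' j].
Proof.
move=> n0 An A'n out Anz outnz.
have Pn : P n = P' n by rewrite -(prednK n0) PS P'S An A'n !mulr0.
have step j : (j < n)%N -> j != l ->
    P j.+1 - P' j.+1 = (P j - P' j) * (g j + A j + B j).
  move=> jn jl; have := cycles jn; have := out j jn.
  rewrite PS P'S g_off_l // g'_off_l // !add0r => outj cycj.
  transitivity (P j * (A j + B j) - P' j * (A' j + B' j) - B j * P j + B' j * P' j).
    by ring.
  by rewrite cycj -outj; ring.
have Pfwd j : (j <= l)%N -> (j <= n)%N -> P j = P' j.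
  elim: j => [|j IH] jl jn; first by rewrite /P /P' !big_ord0.
  have jl' : j != l by rewrite neq_ltn jl.
  by apply/eqP; rewrite -subr_eq0 step // IH ?subrr ?mul0r // ltnW.
have Pbwd k : (l < n - k)%N -> P (n - k)%N = P' (n - k)%N.
  elim: k => [|k IH]; first by rewrite subn0.
  move=> lk; have kn : (n - k = (n - k.+1).+1)%N by lia.
  have jn : (n - k.+1 < n)%N by lia.
  have lj : (n - k.+1)%N != l by rewrite neq_ltn lk orbT.
  apply/eqP; rewrite -subr_eq0 -(mulIr_eq0 _ (mulIf (outnz _ jn))) -step //.
  by rewrite -kn IH ?subrr //; lia.
have PE j : (j <= n)%N -> P j = P' j.
  case: (leqP j l) => [|lj jn]; first exact: Pfwd.
  by rewrite -(subKn jn); apply: Pbwd; rewrite subKn.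
have Pnz j : (j < n)%N -> P j != 0.
  by move=> jn; apply/prodf_neq0 => i _; apply: Anz; have := ltn_ord i; lia.
move=> j jn; have Bj : B j = B' j.
  by apply: (mulIf (Pnz j jn)); rewrite cycles // -PE // ltnW.
have Aj : A j = A' j.
  by apply: (mulfI (Pnz j jn)); rewrite -PS PE // P'S -PE // ltnW.
by split=> //; have := out j jn; rewrite Aj Bj => /addIr/addIr.
Qed.

(** In the relabelled model A j leaves compartment j + 1 and all B j leave the
    hub. The A j with j + 1 != l are known. If l = k + 1, then the B j with
    j <= k are known, and so are the products B j * A k with j > k. The outflow
    of the hub gives the sum of the B j with j > k, by which the sum of these
    products is divided to obtain A k. *)
Lemma outgoing_recovery : (l < n)%N ->
  g 0%N + \sum_(0 <= j < n) B j = g' 0%N + \sum_(0 <= j < n) B' j ->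
  (forall j, (j.+1 < n)%N -> g j.+1 + A j = g' j.+1 + A' j) ->
  (forall j, (j < n.-1)%N -> A j != 0) ->
  (forall k, (k < n)%N -> \sum_(k <= j < n) B j != 0) ->
  (forall j, (j < n)%N -> B j = B' j /\ g j = g' j) /\
  (forall j, (j.+1 < n)%N -> A j = A' j).
Proof.
move=> ln out0 out Anz Bnz.
have A_off j : (j.+1 < n)%N -> j.+1 != l -> A j = A' j.
  by move=> jn jl; have := out j jn; rewrite g_off_l // g'_off_l // !add0r.
have Pnz j : (j < n)%N -> P j != 0.
  by move=> jn; apply/prodf_neq0 => i _; apply: Anz; have := ltn_ord i; lia.
have PE j : (j < n)%N -> (l == 0%N) || (j < l)%N -> P j = P' j.
  move=> jn jl; apply: eq_bigr => i _; apply: A_off; have := ltn_ord i; lia.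
have BE j : (j < n)%N -> (l == 0%N) || (j < l)%N -> B j = B' j.
  move=> jn jl; apply: (mulIf (Pnz j jn)).
  by rewrite cycles // -PE.
suff [BB AA] : (forall j, (j < n)%N -> B j = B' j) /\
               (forall j, (j.+1 < n)%N -> A j = A' j).
  split=> // -[|j] jn; split; rewrite ?BB //.
    move: out0; rewrite (eq_big_nat _ _ (F2 := B')); first by move=> /addIr.
    by move=> i /andP[_ /BB].
  by have := out j jn; rewrite AA // => /addIr.
case: l ln A_off PE BE g_off_l g'_off_l => [|k] ln A_off PE BE gl g'l.
  by split=> j jn; [exact: BE|exact: A_off].
have PA j : (k < j)%N -> (j < n)%N -> P j * A' k = P' j * A k.
  elim: j => // j IH; rewrite ltnS leq_eqVlt => /orP[/eqP<-|kj] jn.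
    rewrite PS P'S PE ?(ltnW ln) ?ltnSn ?orbT //.
    by ring.
  rewrite PS P'S -(A_off j) //; last lia.
  by rewrite mulrAC (IH kj (ltnW jn)) mulrAC.
have BA j : (k < j)%N -> (j < n)%N -> B j * A k = B' j * A' k.
  move=> kj jn; apply: (mulIf (Pnz j jn)).
  by rewrite mulrAC cycles // -!mulrA -PA // [P j * _]mulrC.
have kn : (k.+1 <= n)%N by exact: ltnW.
have sumB : \sum_(k.+1 <= j < n) B j = \sum_(k.+1 <= j < n) B' j.
  have n0 : (0 < n)%N by exact: leq_ltn_trans ln.
  move: out0; rewrite gl // g'l // !add0r.
  rewrite !(big_cat_nat (leq0n k.+1) kn) /=.
  rewrite (eq_big_nat _ _ (F2 := B')); first by move=> /addrI.
  by move=> j /andP[_ jk]; apply: BE => //; exact: leq_trans kn.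
have Ak : A k = A' k.
  apply: (mulfI (Bnz _ ln)); rewrite [in RHS]sumB !mulr_suml.
  by apply: eq_big_nat => j /andP[kj jn]; exact: BA.
have Aknz : A k != 0 by apply: Anz; lia.
split=> j jn.
  case: (leqP j k) => kj; first exact: BE.
  by apply: (mulIf Aknz); rewrite BA // Ak.
by have [[->]//|jk] := eqVneq j k; apply: A_off; rewrite ?eqSS.
Qed.

End Recovery.

(** * Parameters and coefficients of a compartmental model *)

Section ModelCoefficients.
Local Open Scope ring_scope.
Variables (R : realType) (n : nat) (M : compartmental_model n).
Local Notation params := 'rV[R]_(#|edges M| + #|leaks M|).
Implicit Types (x y : params) (e : 'I_n * 'I_n) (i j : 'I_n).

(** In the definitions of the parameters, the membership test is both the
    proposition and the boolean index of the proof that is matched on, so that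
    direct case analysis would generalize the two together. These lemmas keep
    them apart. *)
Lemma reflect_case_true (P : Prop) (b : bool) (r : reflect P b) (f : P -> R) z
    (h : P) : (forall h1 h2, f h1 = f h2) ->
  (if r is ReflectT h' then f h' else z) = f h.
Proof. by case: r => [h' ff|/(_ h)//]; exact: ff. Qed.

Lemma reflect_case_false (P : Prop) (b : bool) (r : reflect P b) (f : P -> R) z :
  ~ P -> (if r is ReflectT h' then f h' else z) = z.
Proof. by case: r. Qed.

Lemma edge_param_on x e (he : e \in edges M) :
  edge_param x e = x 0 (lshift #|leaks M| (enum_rank_in he e)).
Proof.
apply: (reflect_case_true _ _
  (f := fun h => x 0 (lshift #|leaks M| (enum_rank_in h e)))) => h1 h2.
by rewrite (bool_irrelevance h1 h2).
Qed.

Lemma leak_param_on x j (hj : j \in leaks M) :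
  leak_param x j = x 0 (rshift #|edges M| (enum_rank_in hj j)).
Proof.
apply: (reflect_case_true _ _
  (f := fun h => x 0 (rshift #|edges M| (enum_rank_in h j)))) => h1 h2.
by rewrite (bool_irrelevance h1 h2).
Qed.

Lemma edge_param_off x e : e \notin edges M -> edge_param x e = 0.
Proof. by move=> he; apply: reflect_case_false; apply/negP. Qed.

Lemma leak_param_off x j : j \notin leaks M -> leak_param x j = 0.
Proof. by move=> he; apply: reflect_case_false; apply/negP. Qed.

Lemma edge_param_scalar e : scalar (fun x => edge_param x e).
Proof.
move=> a x y; case: (boolP (e \in edges M)) => he.
  by rewrite !edge_param_on !mxE.
by rewrite !edge_param_off // mulr0 addr0.
Qed.

Lemma leak_param_scalar j : scalar (fun x => leak_param x j).
Proof.
move=> a x y; case: (boolP (j \in leaks M)) => hj.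
  by rewrite !leak_param_on !mxE.
by rewrite !leak_param_off // mulr0 addr0.
Qed.

Lemma params_ext x y : (forall e, edge_param x e = edge_param y e) ->
  (forall j, leak_param x j = leak_param y j) -> x = y.
Proof.
move=> exy lxy; apply/rowP => t; case: (split_ordP t) => s ->.
  by have := exy (enum_val s); rewrite !(edge_param_on _ (enum_valP s)) enum_valK_in.
by have := lxy (enum_val s); rewrite !(leak_param_on _ (enum_valP s)) enum_valK_in.
Qed.

(** Witnesses that linear forms in the parameters are nonzero. *)
Lemma edge_unit_exists e : e \in edges M -> exists x : params,
  (forall e', edge_param x e' = (e' == e)%:R) /\ (forall j, leak_param x j = 0).
Proof.
move=> eE; exists (delta_mx 0 (lshift _ (enum_rank_in eE e))); split=> [e'|j].
  have [e'E|e'E] := boolP (e' \in edges M); last first.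
    by rewrite edge_param_off //; case: eqP e'E => // ->; rewrite eE.
  rewrite edge_param_on mxE eqxx /= (inj_eq (@lshift_inj _ _)).
  have [e'e|e'e] := eqVneq e' e.
    rewrite (_ : enum_rank_in e'E e' = enum_rank_in eE e) ?eqxx //.
    by apply: enum_val_inj; rewrite !enum_rankK_in.
  case: eqP => // /(congr1 enum_val); rewrite !enum_rankK_in // => e'e2.
  by rewrite e'e2 eqxx in e'e.
have [jL|jL] := boolP (j \in leaks M); last by rewrite leak_param_off.
by rewrite leak_param_on mxE eqxx /= eq_rlshift.
Qed.

Definition outflow x i : R := leak_param x i + \sum_p edge_param x (i, p).

Lemma outflow_scalar i : scalar (fun x => outflow x i).
Proof.
move=> a x y; rewrite /outflow leak_param_scalar.
under eq_bigr do rewrite edge_param_scalar.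
rewrite big_split -mulr_sumr /=; ring.
Qed.

(** The labels dropped from the coefficient map are those of constant
    coefficients, so they carry no information. *)
Lemma coefficient_map_io_coef x y l :
  coefficient_map x = coefficient_map y -> occurring_label M l ->
  io_coef x l = io_coef y l.
Proof.
move=> /rowP cxy occl; case: (boolP (l \in coef_labels R M)) => [lM|].
  by have := cxy (enum_rank_in lM l); rewrite !mxE enum_rankK_in.
rewrite inE occl /= negb_and !negbK => /orP[] /asboolP ioE; by rewrite !ioE.
Qed.

Lemma coefficient_map_lhs x y i : i \in outputs M ->
  coefficient_map x = coefficient_map y -> lhs_operator x = lhs_operator y.
Proof.
move=> io cxy; apply/polyP => d.
have szl (z : params) : (size (lhs_operator z) <= n.+1)%N.
  rewrite /lhs_operator /operator_matrix -/(char_poly_mx _) -/(char_poly _).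
  by rewrite size_char_poly.
case: (ltnP d n.+1) => dn; last by rewrite !nth_default // (leq_trans (szl _)).
exact: (@coefficient_map_io_coef x y (inl (i, Ordinal dn))).
Qed.

Lemma coefficient_map_rhs x y i j : i \in outputs M -> j \in inputs M ->
  (size (rhs_operator x i j) <= n.+1)%N -> (size (rhs_operator y i j) <= n.+1)%N ->
  coefficient_map x = coefficient_map y ->
  rhs_operator x i j = rhs_operator y i j.
Proof.
move=> io ji szx szy cxy; apply/polyP => d.
case: (ltnP d n.+1) => dn.
  apply: (@coefficient_map_io_coef x y (inr (i, j, Ordinal dn))) => //=.
  by rewrite io ji.
by rewrite !nth_default // (leq_trans _ dn).
Qed.

End ModelCoefficients.

Section ModelNetwork.
Local Open Scope ring_scope.
Variables (R : realType) (m : nat) (M : compartmental_model m.+2).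
Local Notation V := 'I_m.+2.
Local Notation params := 'rV[R]_(#|edges M| + #|leaks M|).
Implicit Types (x y : params) (i j : V).

Definition weights x (j i : V) : R := edge_param x (j, i).

Lemma operator_matrix_network x :
  operator_matrix x = network_mx (weights x) (outflow x).
Proof.
apply/matrixP => i j; rewrite !mxE /weights /outflow.
have [->|ij] /= := eqVneq i j.
  rewrite mulr1n [in LHS]big_mkcond /=; congr (_ + _).
  rewrite (eq_bigr (fun p => edge_param x (j, p))); last first.
    by move=> p _; case: ifPn => // /edge_param_off->.
  case: ifPn => [_|/leak_param_off->]; by rewrite -polyCN ?opprD ?opprK ?add0r.
rewrite mulr0n add0r; case: ifPn => // /edge_param_off->.
by rewrite polyC0 oppr0.
Qed.

Hypothesis cycle_off_hub : forall j i,
  j != 0 -> i != 0 -> (j, i) \in edges M -> i = j + 1.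

(** Off the hub only the path 1 -> 2 -> ... -> n - 1 remains, so the minor is
    lower triangular. *)
Lemma rhs_operator_hub x : rhs_operator x 0 0 =
  \prod_(j < m.+1) ('X + (outflow x (lift ord0 j))%:P).
Proof.
rewrite /rhs_operator addn0 expr0 mul1r operator_matrix_network det_trig.
  by apply: eq_bigr => i _; rewrite !mxE eqxx.
apply/is_trig_mxP => i j ij; rewrite !mxE.
rewrite (inj_eq lift_inj) -(inj_eq val_inj) /= ltn_eqF //.
rewrite /weights edge_param_off ?oppr0 //.
apply/negP => /(cycle_off_hub (isT : lift ord0 j != 0) (isT : lift ord0 i != 0)).
move=> /(congr1 val); rewrite val_add1_ord /= /bump /= !add1n.
case: (ltnP j.+2 m.+2) => jm.
  by rewrite modn_small // => -[ij']; rewrite ij' ltnNge leqnSn in ij.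
suff -> : j.+2 = m.+2 by rewrite modnn.
by apply/eqP; rewrite eqn_leq jm andbT; exact: ltn_ord j.
Qed.

Hypothesis hub_io : (0 \in inputs M) && (0 \in outputs M).

Lemma coefficient_map_hub x y : coefficient_map x = coefficient_map y ->
  \det (network_mx (weights x) (outflow x)) =
    \det (network_mx (weights y) (outflow y)) /\
  \prod_(j < m.+1) ('X + (outflow x (lift ord0 j))%:P) =
    \prod_(j < m.+1) ('X + (outflow y (lift ord0 j))%:P).
Proof.
have [hin hout] := andP hub_io => cxy; split.
  by have := coefficient_map_lhs hout cxy; rewrite /lhs_operator !operator_matrix_network.
have sz (z : params) : (size (rhs_operator z 0%R 0%R) <= m.+3)%N.
  rewrite rhs_operator_hub size_prod => [|j _]; last first.
    by rewrite -size_poly_eq0 size_XaddC.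
  under eq_bigr do rewrite size_XaddC.
  rewrite sum_nat_const card_ord; lia.
by have := coefficient_map_rhs hout hin (sz x) (sz y) cxy; rewrite !rhs_operator_hub.
Qed.

Hypothesis cycleE : forall i, (i, i + 1) \in edges M.

Lemma cycle_strongly_connected : strongly_connected M.
Proof.
move=> i j; rewrite -[j](subrK i) addrC -[j - i]natr_Zp.
elim: (val (j - i)) => [|k IH]; first by rewrite mulr0n addr0 connect0.
rewrite -natr1 addrA; apply: connect_trans IH _; apply: connect1.
exact: cycleE.
Qed.

Lemma cycle_edge_nonzero i : exists x, edge_param x (i, i + 1) != 0.
Proof.
have [x [xe _]] := edge_unit_exists R (cycleE i).
by exists x; rewrite xe eqxx oner_eq0.
Qed.

Lemma outflow_unit i : exists x, forall j, outflow x j = (j == i)%:R.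
Proof.
have [x [xe xl]] := edge_unit_exists R (cycleE i); exists x => j.
rewrite /outflow xl add0r; have [->|ji] := eqVneq j i.
  rewrite (bigD1 (i + 1)) //= xe eqxx big1 ?addr0 // => p pi.
  by rewrite xe xpair_eqE eqxx (negPf pi).
by rewrite big1 // => p _; rewrite xe xpair_eqE (negPf ji).
Qed.

Lemma outflow_nonzero i : exists x, outflow x i != 0.
Proof. by have [x xo] := outflow_unit i; exists x; rewrite xo eqxx oner_eq0. Qed.

Lemma outflow_neq i j : i != j -> exists x, outflow x i != outflow x j.
Proof.
move=> ij; have [x xo] := outflow_unit i; exists x.
by rewrite !xo eqxx [j == i]eq_sym (negPf ij) oner_eq0.
Qed.

End ModelNetwork.

(** * Cycles with chords at the hub *)

Section Cycle.
Local Open Scope ring_scope.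
Variables (R : realType) (m : nat) (M : compartmental_model m.+2) (l : 'I_m.+2).
Local Notation V := 'I_m.+2.
Local Notation params := 'rV[R]_(#|edges M| + #|leaks M|).
Implicit Types (x y : params) (i j : V).
Hypothesis loopless : (0, 0) \notin edges M.
Hypothesis cycleE : forall i, (i, i + 1) \in edges M.
Hypothesis hub_io : (0 \in inputs M) && (0 \in outputs M).
Hypothesis leak_at : forall j, j != l -> j \notin leaks M.

(** The forms that must not vanish are the cycle parameters and the outflows. *)
Lemma incoming_identifiable :
  (forall j i, (j, i) \in edges M -> i = j + 1 \/ i = 0) ->
  generically_locally_identifiable R M.
Proof.
move=> into_hub.
have off_hub j i : j != 0 -> i != 0 -> (j, i) \in edges M -> i = j + 1.
  by move=> _ i0 /into_hub[//|i0']; rewrite i0' eqxx in i0.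
have hubW x : points_to_hub (weights x).
  move=> j i i0 ij; apply: edge_param_off; apply/negP => /into_hub[] e.
    by rewrite e eqxx in ij.
  by rewrite e eqxx in i0.
(* The last cycle edge n - 1 -> 0 enters the hub and is counted in B, whence
   the value 0 of A at n - 1. *)
pose A x k := if (k.+1 < m.+2)%N then weights x k%:R k.+1%:R else 0.
pose B x k := weights x k%:R 0.
pose g x k := leak_param x k%:R.
have outE x k : (k < m.+2)%N -> outflow x k%:R = g x k + A x k + B x k.
  move=> km; rewrite /outflow -addrA /g; congr (_ + _).
  rewrite (bigD1 0) //= addrC; congr (_ + _); rewrite /A.
  have [k1|k1] := ltnP k.+1 m.+2; last first.
    rewrite big1 // => p p0; apply: hubW => //.
    have kE : k.+1 = m.+2 by apply/eqP; rewrite eqn_leq km.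
    by rewrite -(inj_eq val_inj) val_add1_ord val_natr_ord // kE modnn.
  rewrite (bigD1 k.+1%:R) /=; last by rewrite -(inj_eq val_inj) val_natr_ord.
  by rewrite big1 ?addr0 // => p /andP[p0 pk]; apply: hubW => //; rewrite natr1.
split; first exact: cycle_strongly_connected.
  by apply/finset.set0Pn; exists 0; case/andP: hub_io.
pose phi (t : V + V) x :=
  match t with inl i => edge_param x (i, i + 1) | inr i => outflow x i end.
apply: (@generic_local_injectivity R _ (V + V)%type 'I_m.+1 _ phi
  (fun (u : 'I_m.+1) x => outflow x (lift ord0 u)) (@coefficient_map R _ M)).
- by case=> i; [exact: edge_param_scalar|exact: outflow_scalar].
- by case=> i; [exact: cycle_edge_nonzero|exact: outflow_nonzero].
- by move=> j; exact: outflow_scalar.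
- by move=> u v uv; apply: outflow_neq => //; rewrite (inj_eq lift_inj).
- by move=> x y /(coefficient_map_hub off_hub hub_io)[].
move=> x y phix /(coefficient_map_hub off_hub hub_io)[eq_det _] eq_out.
have out_off i : i != 0 -> outflow x i = outflow y i.
  by rewrite eq_sym => i0; have [j -> _] := unlift_some i0; exact: eq_out.
have [out0 cw] := network_recovery (hubW x) (hubW y) out_off eq_det.
have out i : outflow x i = outflow y i by have [->//|/out_off] := eqVneq i 0.
have g_off z k : (k < m.+2)%N -> k != val l -> g z k = 0.
  move=> km kl; apply: leak_param_off; apply: leak_at.
  by apply: contra_neq kl => <-; rewrite val_natr_ord.
have AE z k : (k < m.+1)%N -> A z k = weights z k%:R k.+1%:R.
  by move=> km; rewrite /A ltnS km.
have PE z k : (k < m.+2)%N ->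
    B z k * \prod_(i < k) A z i = cycle_weight (weights z) k.
  move=> km; congr (_ * _); apply: eq_bigr => i _; apply: AE.
  exact: leq_trans (ltn_ord i) _.
have B0 z : B z 0%N = 0 by apply: edge_param_off; rewrite mulr0n.
have rec : forall k, (k < m.+2)%N ->
    [/\ A x k = A y k, B x k = B y k & g x k = g y k].
  apply: (@incoming_recovery R m.+2 (val l)) => //.
  - exact: g_off.
  - exact: g_off.
  - by case=> [|k] km; rewrite ?B0 ?mul0r // !PE // cw.
  - by rewrite /A ltnn.
  - by rewrite /A ltnn.
  - by move=> k km; rewrite -!outE // out.
  - by move=> k km; rewrite AE // -natr1; exact: (phix (inl _)).
  - by move=> k km; rewrite -outE //; exact: (phix (inr _)).
apply: params_ext => [[j i]|j]; last first.
  by have [_ _] := rec j (ltn_ord j); rewrite /g natr_Zp.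
have [Aj Bj _] := rec j (ltn_ord j).
have [->|i0] := eqVneq i 0; first by move: Bj; rewrite /B natr_Zp.
have [ij|ij] := eqVneq i (j + 1); last by rewrite -!/(weights _ _ _) !hubW.
rewrite ij; case: (ltnP j.+1 m.+2) => jm.
  by move: Aj; rewrite !AE // -natr1 natr_Zp.
have jE : j.+1 = m.+2 by apply/eqP; rewrite eqn_leq jm andbT; exact: ltn_ord j.
by case/eqP: i0; apply: val_inj; rewrite ij val_add1_ord jE modnn.
Qed.

(** The forms that must not vanish are the cycle parameters and the sums of the
    parameters out of the hub to the compartments 1, ..., i, for i >= 1. *)
Lemma outgoing_identifiable :
  (forall j i, (j, i) \in edges M -> i = j + 1 \/ j = 0) ->
  generically_locally_identifiable R M.
Proof.
move=> from_hub.
have off_hub j i : j != 0 -> i != 0 -> (j, i) \in edges M -> i = j + 1.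
  by move=> j0 _ /from_hub[//|j0']; rewrite j0' eqxx in j0.
(* Reversing the edges and relabelling i as - i makes the chords enter the hub
   and turns the cycle into itself. *)
pose W x u v := weights x (- v) (- u).
have hubW x : points_to_hub (W x).
  move=> j i i0 ij; apply: edge_param_off; apply/negP => /from_hub[e|/eqP].
    by case/eqP: ij; rewrite -[j]opprK e; ring.
  by rewrite oppr_eq0 (negPf i0).
have detW x : \det (network_mx (W x) (fun i => outflow x (- i))) =
    \det (network_mx (weights x) (outflow x)).
  rewrite -[RHS]det_tr -[RHS](det_reindex (perm (@oppr_inj V))).
  congr (\det _); apply/matrixP => i j; rewrite !mxE !permE /= eqr_opp.
  by rewrite eq_sym; have [->|] := eqVneq i j.
pose A x k := W x k%:R k.+1%:R.
pose B x k := W x k%:R 0.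
pose g x k := leak_param x (- k%:R).
have out0E x : outflow x 0 = g x 0%N + \sum_(0 <= k < m.+2) B x k.
  rewrite /outflow /g mulr0n oppr0; congr (_ + _).
  rewrite (reindex_inj (@oppr_inj V)) big_mkord; apply: eq_bigr => i _ /=.
  by rewrite /B /W oppr0 natr_Zp.
have outE x k : (k.+1 < m.+2)%N -> outflow x (- k.+1%:R) = g x k.+1 + A x k.
  move=> km; rewrite /outflow; congr (_ + _).
  rewrite (bigD1 (- k%:R)) //= big1 ?addr0 // => p pk.
  apply: edge_param_off; apply/negP => /from_hub[] /eqP.
    by rewrite -natr1 opprD subrK (negPf pk).
  by rewrite oppr_eq0 -(inj_eq val_inj) val_natr_ord.
split; first exact: cycle_strongly_connected.
  by apply/finset.set0Pn; exists 0; case/andP: hub_io.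
pose phi (t : V + V) x :=
  match t with
  | inl i => edge_param x (i, i + 1)
  | inr i => \sum_(val i <= k < m.+2) B x k
  end.
apply: (@generic_local_injectivity R _ (V + V)%type 'I_m.+1 _ phi
  (fun (u : 'I_m.+1) x => outflow x (lift ord0 u)) (@coefficient_map R _ M)).
- case=> i; first exact: edge_param_scalar.
  move=> a x y; rewrite /phi /B /W /weights.
  under eq_bigr do rewrite edge_param_scalar.
  by rewrite big_split mulr_sumr.
- case=> i; first exact: cycle_edge_nonzero.
  have [x [xe _]] := edge_unit_exists R (cycleE 0); exists x.
  rewrite /phi big_nat_recr; last by have := ltn_ord i; rewrite ltnS.
  (* The term of index n - 1 is the parameter of the cycle edge 0 -> 1. *)
  have last1 : B x m.+1 = 1.
    rewrite /B /W /weights xe oppr0 (_ : - m.+1%:R = 0 + 1 :> V) ?eqxx //.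
    apply/eqP; rewrite add0r eq_sym -addr_eq0 addrC natr1 Zp_nat.
    by rewrite -(inj_eq val_inj) /= modnn.
  apply: lt0r_neq0; apply: ltr_wpDl; last by rewrite last1.
  by apply: sumr_ge0 => k _; rewrite /B /W /weights xe ler0n.
- by move=> j; exact: outflow_scalar.
- by move=> u v uv; apply: outflow_neq => //; rewrite (inj_eq lift_inj).
- by move=> x y /(coefficient_map_hub off_hub hub_io)[].
move=> x y phix /(coefficient_map_hub off_hub hub_io)[eq_det _] eq_out.
have out_off i : i != 0 -> outflow x i = outflow y i.
  by rewrite eq_sym => i0; have [j -> _] := unlift_some i0; exact: eq_out.
have out_offN i : i != 0 -> outflow x (- i) = outflow y (- i).
  by move=> i0; apply: out_off; rewrite oppr_eq0.
rewrite -!detW in eq_det.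
have [out0 cw] := network_recovery (hubW x) (hubW y) out_offN eq_det.
rewrite oppr0 in out0.
have g_off z k : (k < m.+2)%N -> k != val (- l) -> g z k = 0.
  move=> km kl; apply: leak_param_off; apply: leak_at.
  by apply: contra_neq kl => <-; rewrite opprK val_natr_ord.
have B0 z : B z 0%N = 0 by apply: edge_param_off; rewrite mulr0n oppr0.
have [||||||BG AA] := @outgoing_recovery R m.+2 (val (- l)) (A x) (B x) (g x)
  (A y) (B y) (g y) (g_off x) (g_off y).
- by case=> [|k] km; rewrite ?B0 ?mul0r //; exact: cw.
- exact: ltn_ord.
- by rewrite -!out0E.
- move=> k km; rewrite -!outE //; apply: out_offN.
  by rewrite -(inj_eq val_inj) val_natr_ord.
- move=> k km; have := phix (inl (- k.+1%:R)).
  by rewrite /= (_ : - k.+1%:R + 1 = - k%:R :> V) // -natr1 opprD subrK.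
- by move=> k km; have := phix (inr (inord k)); rewrite /= inordK.
apply: params_ext => [[j i]|j]; last first.
  by have [_] := BG _ (ltn_ord (- j)); rewrite /g natr_Zp opprK.
have [->|j0] := eqVneq j 0.
  by have [+ _] := BG _ (ltn_ord (- i)); rewrite /B /W natr_Zp opprK oppr0.
have [->|ij] := eqVneq i (j + 1); last first.
  have notE : (j, i) \notin edges M.
    apply/negP => /from_hub[e|e]; first by rewrite e eqxx in ij.
    by rewrite e eqxx in j0.
  by rewrite !edge_param_off.
have nj0 : (0 < val (- j)%R)%N by rewrite lt0n; move: j0; rewrite -oppr_eq0.
have kE : (val (- j)%R).-1.+1 = val (- j) by rewrite prednK.
have := AA (val (- j)%R).-1; rewrite kE => /(_ (ltn_ord _)).
rewrite /A /W /weights kE natr_Zp opprK.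
suff -> : - (val (- j)%R).-1%:R = j + 1 by [].
have e : (val (- j)%R).-1%:R + 1 = - j :> V by rewrite natr1 kE natr_Zp.
by apply: oppr_inj; rewrite opprK opprD -[X in _ = X - 1]e addrK.
Qed.

End Cycle.

Section Chords.
Local Open Scope ring_scope.

Lemma cycle_edgesE m (j i : 'I_m.+2) : ((j, i) \in cycle_edges m.+2) = (i == j + 1).
Proof. by rewrite inE /= -(inj_eq val_inj) val_add1_ord. Qed.

(** The models with and without the leak are treated at once, as those with leaks
    in a singleton. *)
Lemma cycle_with_chords (R : realType) m (C F L : {set _}) (l : 'I_m.+2) :
  C = incoming_edges m.+2 \/ C = outgoing_edges m.+2 -> F \subset C ->
  L \subset [set l]%SET ->
  generically_locally_identifiable R
    (CompartmentalModel (cycle_edges m.+2 :|: F)%SET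
       (first_compartment m.+2) (first_compartment m.+2) L).
Proof.
move=> inout FC Ll; set M := CompartmentalModel _ _ _ _.
have edgesP j i : (j, i) \in edges M -> i = j + 1 \/ (j, i) \in C.
  rewrite finset.in_setU cycle_edgesE => /orP[/eqP|/(fintype.subsetP FC)];
    by [left|right].
have loopless : (0, 0) \notin edges M.
  apply/negP => /edgesP[/(congr1 val)|].
    by rewrite val_add1_ord modn_small.
  by case: inout => ->; rewrite inE.
have cycleE i : (i, i + 1) \in edges M by rewrite finset.in_setU cycle_edgesE eqxx.
have hub_io : (0 \in inputs M) && (0 \in outputs M) by rewrite !inE.
have leak_at j : j != l -> j \notin leaks M.
  by apply: contra => /(fintype.subsetP Ll); rewrite inE.
case: inout => CE; subst C.
- apply: (incoming_identifiable R loopless cycleE hub_io leak_at) => j i /edgesP[|].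
    by left.
  by rewrite inE => /andP[_ /eqP i0]; right; apply: val_inj.
- apply: (outgoing_identifiable R loopless cycleE hub_io leak_at) => j i /edgesP[|].
    by left.
  by rewrite inE => /andP[/eqP j0 _]; right; apply: val_inj.
Qed.

End Chords.

Theorem theorem3p19 (R : realType) (n : nat) (F : {set 'I_n * 'I_n})
    (Leak : {set 'I_n}) :
  (3 <= n)%N ->
  [\/ (F \subset incoming_edges n) && (#|F| == 1%N),
      (F \subset outgoing_edges n) && (#|F| == 1%N) |
      [&& (4 <= n)%N, F \subset outgoing_edges n & #|F| == 2%N]] ->
  #|Leak| = 1%N ->
  let E := (cycle_edges n :|: F)%SET in
  let I := first_compartment n in
  generically_locally_identifiable R (CompartmentalModel E I I Leak) /\
  generically_locally_identifiable R (CompartmentalModel E I I finset.set0).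
Proof.
case: n F Leak => [|[|m]] // F Leak _ chords /eqP/cards1P[l ->] E I.
have [C inout FC] : exists2 C,
    C = incoming_edges m.+2 \/ C = outgoing_edges m.+2 & F \subset C.
  case: chords => [/andP[FC _]|/andP[FC _]|/and3P[_ FC _]].
  - by exists (incoming_edges m.+2); [left|].
  - by exists (outgoing_edges m.+2); [right|].
  - by exists (outgoing_edges m.+2); [right|].
split; apply: (cycle_with_chords R (l := l) inout FC).
  exact: fintype.subxx.
exact: finset.sub0set.
Qed.
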